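(* Let $X$ be a chainable continuum and let $\leq_{\mathcal{U}}^{\mathcal{D}}$ be an ultrafilter order on $X$. If the set $M=\{(x,y)\in X^2:x\leq_{\mathcal{U}}^{\mathcal{D}}y\}$ is closed in $X^2$, then the space $X$ is homeomorphic to the closed interval $[0,1]$.
   Context: A continuum is a compact connected metrizable space; fix a metric generating its topology. A chain in $X$ is a finite sequence of open sets $d_1,\dots,d_k$ (its links) with $d_i\cap d_j\neq\varnothing\iff|i-j|\le 1$; its mesh is the maximum of the diameters of its links. $X$ is chainable if for every $\varepsilon>0$ it is covered by a chain of mesh less than $\varepsilon$. $\mathbb{N}=\{1,2,3,\dots\}$. Let $\mathcal{D}=\{D_n\}_{n\in\mathbb{N}}$ be a sequence of chains $D_n=\{d_{1,n},\dots,d_{k_n,n}\}$, each covering $X$, with $\mathrm{mesh}(D_n)\to 0$, and let $\mathcal{U}$ be a non-principal ultrafilter on $\mathbb{N}$. Write $x\leq_{D_n}y$ iff there exist $i\le j\le k_n$ with $x\in d_{i,n}$ and $y\in d_{j,n}$, and $x\leq_{\mathcal{U}}^{\mathcal{D}}y$ iff $\{n\in\mathbb{N}: x\leq_{D_n}y\}\in\mathcal{U}$. This is a linear order on $X$. An ultrafilter order on $X$ is any order of the form $\leq_{\mathcal{U}}^{\mathcal{D}}$ for some such $\mathcal{D}$ and $\mathcal{U}$.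
   Formalization: The continuum X is assumed to have at least two points: the one-point space is a chainable continuum with M closed but is not homeomorphic to [0,1]. *)

(* Defs.v *)
From HB Require Import structures.
From mathcomp Require Import all_boot all_order all_algebra.
From mathcomp Require Import all_classical all_reals all_analysis.

Set Implicit Arguments.
Unset Strict Implicit.
Unset Printing Implicit Defensive.

Import Order.TTheory GRing.Theory Num.Theory.
Import numFieldNormedType.Exports.

Local Open Scope classical_set_scope.
Local Open Scope ring_scope.

Definition homeomorphic (S T : topologicalType) : Prop :=
  exists (f : S -> T) (g : T -> S),
    [/\ cancel f g, cancel g f, continuous f & continuous g].

(* The underlying space of a metricType is metrizable, with mdist as the fixed
   metric.  The one-point space is a continuum for this definition; the empty
   space satisfies it as well. *)
Definition continuum (R : realType) (X : metricType R) : Prop :=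
  compact [set: X] /\ connected [set: X].

(* Extended-real valued, so that no set receives a default value: an unbounded
   set has diameter +oo. *)
Definition diam (R : realType) (X : metricType R) (A : set X) : \bar R :=
  ereal_sup [set (mdist p.1 p.2)%:E | p in A `*` A].

(* A finite sequence of sets d_1, ..., d_k is a seq, and d_(i+1) is
   [link D i]; the default value set0 is only reached when size D <= i. *)
Definition link (T : Type) (D : seq (set T)) (i : nat) : set T := nth set0 D i.

(* The case i = j of the second clause says that all links are nonempty. *)
Definition chain (X : topologicalType) (D : seq (set X)) : Prop :=
  (forall i, (i < size D)%N -> open (link D i)) /\
  (forall i j, (i < size D)%N -> (j < size D)%N ->
     (link D i `&` link D j !=set0 <-> `|i%:Z - j%:Z| <= 1)).

Definition mesh (R : realType) (X : metricType R) (D : seq (set X)) : \bar R :=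
  \big[maxe/0%E]_(d <- D) diam d.

Definition covers (T : Type) (D : seq (set T)) : Prop :=
  cover `I_(size D) (link D) = [set: T].

Definition chainable (R : realType) (X : metricType R) : Prop :=
  forall e : R, 0 < e ->
    exists D : seq (set X), [/\ chain D, covers D & (mesh D < e%:E)%E].

Definition le_chain (T : Type) (D : seq (set T)) (x y : T) : Prop :=
  exists i j, [/\ (i <= j)%N, (j < size D)%N, link D i x & link D j y].

Definition chain_sequence (R : realType) (X : metricType R)
    (D : nat -> seq (set X)) : Prop :=
  (forall n, chain (D n) /\ covers (D n)) /\ mesh (D n) @[n --> \oo] --> 0%E.

Definition nonprincipal_ultrafilter (T : Type) (U : set_system T) : Prop :=
  UltraFilter U /\ forall t : T, U <> principal_filter t.

Definition le_ultra (T : Type) (D : nat -> seq (set T)) (U : set_system nat)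
    (x y : T) : Prop :=
  U [set n | le_chain (D n) x y].

(* Main.v *)
Require Import Defs.
From HB Require Import structures.
From mathcomp Require Import all_boot all_order all_algebra.
From mathcomp Require Import all_classical all_reals all_analysis.
From mathcomp Require Import lra zify.

(** The order [le_ultra D U] is linear, and closed by assumption; and every
    nondegenerate compact connected metric space with a closed linear order is
    an arc.

    For the second point it is enough to find a continuous function f : X -> R
    that is strictly monotone for the order.  Such an f is injective, its image
    is a compact interval with more than one point, and an injective continuous
    function on a compact space is a homeomorphism onto its image
    ([injection_homeomorphic_itv]).

    The function f records how the closed lower rays L_x = {y | y <= x} grow.
    For a point q, the distance from q to L_x is nonincreasing in x.  It is
    also continuous in x: it is the running infimum inf_(y <= x) d(q, y), and
    the running infimum of a continuous function is continuous
    ([continuous_running_inf]) because upward closures of open sets are open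
    and upward closures of closed sets are closed.  If x < y then y is at a
    positive distance from L_x, so a point q close enough to y is closer to L_y
    than to L_x.  Hence, for q_0, q_1, ... dense in X, the sum of
    2^-(k+1) min(1, d(q_k, L_x)) over k is continuous and strictly decreasing in
    x ([continuous_strictly_antitone]).  One point in each link of each chain
    gives the dense sequence.

    For the first point, antisymmetry and transitivity rest on one remark.  Two
    links of a chain with a common point have indices that differ by at
    most 1, so each possible failure of these laws in the single relation
    [le_chain (D n)] confines two points to at most three consecutive links.
    For distinct points this happens for finitely many n only, as the mesh
    tends to 0, and a nonprincipal ultrafilter ignores finitely many n. *)

Import Order.TTheory GRing.Theory Num.Theory.
Import numFieldNormedType.Exports.

Local Open Scope classical_set_scope.
Local Open Scope ring_scope.

Set Implicit Arguments.
Unset Strict Implicit.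
Unset Printing Implicit Defensive.

(** * The ultrafilter order is a linear order *)

(** An ultrafilter that contains a singleton is the principal one at that
    point; so the points 0, ..., N - 1 can be removed one at a time. *)
Lemma nonprincipal_tail (U : set_system nat) (N : nat) :
  nonprincipal_ultrafilter U -> U [set n | (N <= n)%N].
Proof.
move=> [ultU npU]; elim: N => [|N IH].
  by apply: filterS filterT => n.
have [UN|UnN] := in_ultra_setVsetC [set N] ultU.
  case: (npU N); apply: (max_filter (UltraFilter := principal_filter_ultra N)).
  by move=> A /principal_filterP AN; apply: filterS UN => _ ->.
apply: filterS (filterI IH UnN) => n [/= Nn nN].
by rewrite ltn_neqAle Nn andbT; apply/eqP => /esym.
Qed.

Lemma mdist_link (R : realType) (X : metricType R) (D : seq (set X)) (e : R)
    (i : nat) (x y : X) :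
  (mesh D < e%:E)%E -> link D i x -> link D i y -> mdist x y < e.
Proof.
move=> De xi yi; rewrite -lte_fin; apply: le_lt_trans De.
have iD : (i < size D)%N.
  by rewrite ltnNge; apply/negP => Di; move: xi; rewrite /link nth_default.
apply: (@le_trans _ _ (diam (link D i))).
  by apply: ereal_sup_ubound; exists (x, y).
by apply: le_bigmax_seq => //; exact: mem_nth.
Qed.

Lemma chain_sequence_near (R : realType) (X : metricType R)
    (D : nat -> seq (set X)) (e : R) :
  chain_sequence D -> 0 < e -> \forall n \near \oo, (mesh (D n) < e%:E)%E.
Proof.
move=> [_ meshD] e0; apply: (meshD [set t | (t < e%:E)%E]).
by apply: open_nbhs_nbhs; split; [exact: open_ereal_lt_ereal|rewrite /= lte_fin].
Qed.

(** The form in which the mesh condition is used: whatever holds for all chains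
    of small mesh holds for almost all n in the sense of [U]. *)
Lemma chain_sequence_ultra (R : realType) (X : metricType R)
    (D : nat -> seq (set X)) (U : set_system nat) (e : R) :
  chain_sequence D -> nonprincipal_ultrafilter U -> 0 < e ->
  U [set n | (mesh (D n) < e%:E)%E].
Proof.
move=> chD npU e0; have [N _ DN] := chain_sequence_near chD e0.
have [ultU _] := npU.
by apply: filterS (nonprincipal_tail N npU) => n /= /DN.
Qed.

Lemma covers_ex (T : Type) (D : seq (set T)) (x : T) :
  covers D -> exists2 i, (i < size D)%N & link D i x.
Proof. by move=> cD; have : [set: T] x by []; rewrite -cD => -[i]; exists i. Qed.

(** Links with a common point are adjacent or equal.  Only the bound in this
    direction is stated; the other one follows by exchanging [i] and [j]. *)
Lemma chain_adjacent (X : topologicalType) (D : seq (set X)) (i j : nat) (x : X) :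
  chain D -> link D i x -> link D j x -> (i <= j.+1)%N.
Proof.
have lt_size k : link D k x -> (k < size D)%N.
  by move=> xk; rewrite ltnNge; apply/negP => Dk; move: xk; rewrite /link nth_default.
move=> [_ cD] xi xj.
have /(cD _ _ (lt_size _ xi) (lt_size _ xj)) : link D i `&` link D j !=set0.
  by exists x.
lia.
Qed.

(** Consecutive links meet, so two points that lie at most two links apart are
    joined by a path of at most three steps, each inside one link. *)
Lemma mdist_consecutive (R : realType) (X : metricType R) (D : seq (set X))
    (e : R) (i j : nat) (x y : X) :
  chain D -> (mesh D < e%:E)%E -> link D i x -> link D j y -> (i <= j)%N ->
  (j <= i.+2)%N -> (j < size D)%N -> mdist x y < 3 * e.
Proof.
move=> [_ cD] De xi yj ij ji jD.
have step k u : (k.+1 < size D)%N -> link D k u ->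
    exists2 v, link D k.+1 v & mdist u v < e.
  move=> kD uk.
  have /(cD _ _ (ltnW kD) kD) [v [vk vk1]] : `|k%:Z - k.+1%:Z| <= 1 by lia.
  by exists v => //; exact: mdist_link uk vk.
have e0 : 0 < e by apply: le_lt_trans (mdist_link De xi xi); rewrite mdistxx.
have /orP[/orP[/eqP ij0|/eqP ij1]|/eqP ij2] :
    (j == i) || (j == i.+1) || (j == i.+2) by lia.
- by subst j; have := mdist_link De xi yj; lra.
- subst j; have [v vj xv] := step i x jD xi.
  by have := mdist_link De vj yj; have := metric_triangle x v y; lra.
- subst j; have [v vj xv] := step i x (ltnW jD) xi.
  have [w wj vw] := step i.+1 v jD vj.
  have := mdist_link De wj yj; have := metric_triangle x v y.
  by have := metric_triangle v w y; lra.
Qed.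

Lemma le_ultra_total (R : realType) (X : metricType R)
    (D : nat -> seq (set X)) (U : set_system nat) (x y : X) :
  chain_sequence D -> nonprincipal_ultrafilter U ->
  le_ultra D U x y \/ le_ultra D U y x.
Proof.
move=> [chD _] [ultU _].
have [Uxy|Uxy] := in_ultra_setVsetC [set n | le_chain (D n) x y] ultU.
  by left.
right; apply: filterS Uxy => n nxy /=.
have [i iD xi] := covers_ex x (chD n).2; have [j jD yj] := covers_ex y (chD n).2.
have [ij|ji] := leqP i j; first by case: nxy; exists i, j.
by exists j, i; split => //; exact: ltnW.
Qed.

(** If x lies in d_i and d_j', and y in d_j and d_i', with i <= j and i' <= j',
    then j <= i' + 1 <= j' + 1 <= i + 2; so x and y are at distance less than
    three times the mesh. *)
Lemma le_ultra_anti (R : realType) (X : metricType R)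
    (D : nat -> seq (set X)) (U : set_system nat) (x y : X) :
  chain_sequence D -> nonprincipal_ultrafilter U ->
  le_ultra D U x y -> le_ultra D U y x -> x = y.
Proof.
move=> chD npU Uxy Uyx; have [ultU _] := npU.
apply: contrapT => /eqP xy; have e0 : 0 < mdist x y / 3.
  by rewrite divr_gt0// mdist_gt0.
have Ue := chain_sequence_ultra chD npU e0.
have [n [[/= Dn [i [j [ij jD xi yj]]]] [i' [j' [ij' jD' yi' xj']]]]] :=
  filter_ex (filterI (filterI Ue Uxy) Uyx).
have cD := (chD.1 n).1.
have := chain_adjacent cD yj yi'; have := chain_adjacent cD xj' xi.
move=> ji ij1; have : mdist x y < 3 * (mdist x y / 3).
  by apply: (mdist_consecutive cD Dn xi yj); lia.
by rewrite mulrC divfK// ltxx.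
Qed.

(** The two links chosen for y may be different, but they are adjacent.  So
    either x precedes z in the chain, or the link of z comes just before that
    of x; the second case forces x and z to be close. *)
Lemma le_ultra_trans (R : realType) (X : metricType R)
    (D : nat -> seq (set X)) (U : set_system nat) (x y z : X) :
  chain_sequence D -> nonprincipal_ultrafilter U ->
  le_ultra D U x y -> le_ultra D U y z -> le_ultra D U x z.
Proof.
move=> chD npU Uxy Uyz; have [ultU _] := npU.
have [<-|/eqP xz] := pselect (x = z).
  by case: (le_ultra_total x x chD npU).
have e0 : 0 < mdist x z / 3 by rewrite divr_gt0// mdist_gt0.
have Ue := chain_sequence_ultra chD npU e0.
apply: filterS (filterI (filterI Ue Uxy) Uyz).
move=> n [[/= Dn [i [j [ij jD xi yj]]]] [j' [k [jk kD yj' zk]]]].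
have cD := (chD.1 n).1.
have jj' := chain_adjacent cD yj yj'.
have [ik|ki] := leqP i k; first by exists i, k.
have : mdist z x < 3 * (mdist x z / 3).
  by apply: (mdist_consecutive cD Dn zk xi); lia.
by rewrite metric_sym mulrC divfK// ltxx.
Qed.

(** * Closed linear orders on compact spaces *)

Record closed_linear_order (X : topologicalType) (le : X -> X -> Prop) : Prop :=
  ClosedLinearOrder {
    clo_total : forall x y, le x y \/ le y x ;
    clo_anti : forall x y, le x y -> le y x -> x = y ;
    clo_trans : forall x y z, le x y -> le y z -> le x z ;
    clo_closed : closed [set p : X * X | le p.1 p.2] }.

Lemma clo_refl (X : topologicalType) (le : X -> X -> Prop) (x : X) :
  closed_linear_order le -> le x x.
Proof. by move=> /clo_total /(_ x x) []. Qed.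

Lemma closed_lower_ray (X : topologicalType) (le : X -> X -> Prop) (y : X) :
  closed_linear_order le -> closed [set x | le x y].
Proof.
move=> lo.
apply: (@preimage_closed _ _ (fun x => (x, y)) [set p | le p.1 p.2]).
  by move=> x _; apply: cvg_pair; [exact: cvg_id | exact: cvg_cst].
exact: clo_closed lo.
Qed.

Definition up_closure (X : Type) (le : X -> X -> Prop) (A : set X) : set X :=
  [set x | exists2 y, A y & le y x].

(** A point x above some y in A with y < x has the open ray of all z > y as a
    neighbourhood in the upward closure; the only other points of the upward
    closure are points of the open set A itself. *)
Lemma open_up_closure (X : topologicalType) (le : X -> X -> Prop) (A : set X) :
  closed_linear_order le -> open A -> open (up_closure le A).
Proof.
move=> lo oA; rewrite openE => x [y Ay yx].
have [xy|nxy] := pselect (le x y).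
  rewrite -(clo_anti lo yx xy) /interior; apply: filterS (open_nbhs_nbhs (conj oA Ay)).
  by move=> z Az; exists z => //; exact: clo_refl.
have oy : open (~` [set z | le z y]) by apply: closed_openC; exact: closed_lower_ray.
apply: filterS (open_nbhs_nbhs (conj oy nxy)) => z nzy.
by exists y => //; case: (clo_total lo y z).
Qed.

(** The upward closure is the second projection of the part of the graph of the
    order that lies above A, which is compact. *)
Lemma closed_up_closure (X : topologicalType) (le : X -> X -> Prop) (A : set X) :
  hausdorff_space X -> compact [set: X] -> closed_linear_order le ->
  closed A -> closed (up_closure le A).
Proof.
move=> hX cX lo cA.
have -> : up_closure le A =
    snd @` ([set p : X * X | le p.1 p.2] `&` fst @^-1` A).
  apply/seteqP; split => [x [y Ay yx]|x [[y z]/= [yz Ay] <-]].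
    by exists (y, x).
  by exists y.
apply: compact_closed => //; apply: continuous_compact.
  by apply: continuous_subspaceT => -[x y]; exact: cvg_snd.
apply: (@subclosed_compact _ _ ([set: X] `*` [set: X])) => //.
  apply: closedI; first exact: clo_closed lo.
  by apply: preimage_closed => // -[x y] _; exact: cvg_fst.
exact: compact_setX.
Qed.

Definition running_inf (R : realType) (X : Type) (le : X -> X -> Prop)
    (h : X -> R) (x : X) : R :=
  inf (h @` [set y | le y x]).

Section running_inf.
Context (R : realType) (X : topologicalType) (le : X -> X -> Prop) (h : X -> R)
  (lo : closed_linear_order le) (h0 : forall x, 0 <= h x).

(** The bound [h0] makes the infimum a true one: the infimum of a set of reals
    that is not bounded below has an arbitrary value. *)
Lemma has_inf_ray x : has_inf (h @` [set y | le y x]).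
Proof.
split; first by exists (h x); exists x => //; exact: clo_refl.
by exists 0 => _ [y _ <-].
Qed.

Lemma running_inf_ge c x :
  (forall y, le y x -> c <= h y) -> c <= running_inf le h x.
Proof.
by move=> ch; apply: lb_le_inf (has_inf_ray x).1 _ => _ [y yx <-]; exact: ch.
Qed.

Lemma running_inf_le x y : le y x -> running_inf le h x <= h y.
Proof. by move=> yx; apply: ge_inf (has_inf_ray x).2 _ _; exists y. Qed.

Lemma running_inf_lt c x :
  running_inf le h x < c -> exists2 y, le y x & h y < c.
Proof.
by move=> /(inf_lt (has_inf_ray x).1) [_ [y yx <-] hy]; exists y.
Qed.

Lemma running_inf_antitone x y :
  le x y -> running_inf le h y <= running_inf le h x.
Proof.
move=> xy; apply: running_inf_ge => z zx; apply: running_inf_le.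
exact: (clo_trans lo zx xy).
Qed.

(** The running infimum is smaller than c exactly on the upward closure of
    {h < c}, which is open, and it is larger than c near each point outside
    the upward closure of {h <= c'} for some c' > c, which is closed. *)
Lemma continuous_running_inf :
  hausdorff_space X -> compact [set: X] -> continuous h ->
  continuous (running_inf le h).
Proof.
move=> hX cX ch x; apply/cvgrPdist_lt => e e0.
set g := running_inf le h.
have upper : \forall y \near x, g y < g x + e.
  have [z zx hz] : exists2 z, le z x & h z < g x + e.
    by apply: running_inf_lt; rewrite ltrDl.
  have : open (up_closure le (h @^-1` [set r | r < g x + e])).
    apply: open_up_closure => //.
    by move/continuousP: ch; apply; exact: open_lt.
  move=> oS; have Sx : up_closure le (h @^-1` [set r | r < g x + e]) x by exists z.
  apply: filterS (open_nbhs_nbhs (conj oS Sx)) => y [w hw wy].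
  by apply: le_lt_trans hw; exact: running_inf_le.
have lower : \forall y \near x, g x - e < g y.
  have : closed (up_closure le (h @^-1` [set r | r <= g x - e / 2])).
    apply: closed_up_closure => //.
    by move/continuous_closedP: ch; apply; exact: closed_le.
  move=> /closed_openC oS.
  have Sx : (~` up_closure le (h @^-1` [set r | r <= g x - e / 2])) x.
    move=> [z /= hz zx]; have := running_inf_le zx; rewrite -/g; lra.
  apply: filterS (open_nbhs_nbhs (conj oS Sx)) => y nSy.
  apply: (@lt_le_trans _ _ (g x - e / 2)); first lra.
  apply: running_inf_ge => z zy; rewrite leNgt; apply/negP => hz.
  by apply: nSy; exists z => //; exact: ltW.
near=> y; rewrite ltr_distlC; apply/andP; split; near: y => //.
Unshelve. all: by end_near. Qed.

End running_inf.

(** * A strictly monotone sum of continuous functions *)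

(** The function f is the sum of the u_k / 2^(k+1).  The weights make the series
    converge uniformly, hence f is continuous, and they are positive, hence f
    increases strictly between two points as soon as all the u_k increase and
    one of them does so strictly. *)
Lemma dyadic_series (R : realType) (T : topologicalType) (u : nat -> T -> R) :
  (forall k, continuous (u k)) -> (forall k x, 0 <= u k x <= 1) ->
  exists f : T -> R, continuous f /\
    forall x y, (forall k, u k x <= u k y) -> (exists k, u k x < u k y) ->
      f x < f y.
Proof.
move=> cu u01.
pose S n x : R := \sum_(k < n) u k x / 2 ^+ k.+1.
pose t n : R := 1 / 2 ^+ n.
have SS n x : S n.+1 x = S n x + u n x / 2 ^+ n.+1 by rewrite /S big_ord_recr.
have tS n : t n.+1 = t n / 2 by rewrite /t exprS invfM !mul1r mulrC.
have t0 n : 0 < t n by rewrite divr_gt0// exprn_gt0.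
have uS n x : u n x / 2 ^+ n.+1 = u n x * t n.+1 by rewrite /t mul1r.
have Sup x : {homo S^~ x : n m / (n <= m)%N >-> n <= m}.
  apply/nondecreasing_seqP => n; rewrite SS uS.
  by have := u01 n x; have := t0 n.+1; nra.
(* The tail of the weights after n sums to t n, so S n + t n decreases. *)
have Sdn x : {homo (fun n => S n x + t n) : n m / (n <= m)%N >-> m <= n}.
  apply/nonincreasing_seqP => n; rewrite SS uS.
  have := u01 n x; have := t0 n; rewrite tS; nra.
have Scvg x : cvgn (S^~ x).
  apply: nondecreasing_is_cvgn => //; exists 1 => _ [n _ <-].
  have := Sdn x 0%N n isT; rewrite /S big_ord0 /t expr0 divr1 add0r.
  by have := t0 n; rewrite /t; lra.
pose f x := limn (S^~ x).
have fS n x : S n x <= f x <= S n x + t n.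
  apply/andP; split; first exact: nondecreasing_cvgn_le.
  apply: limr_le => //; exists n => // m /= nm.
  by have := Sdn x n m nm; have := t0 m; rewrite /=; lra.
have tsmall e : 0 < e -> exists N, forall n, (N <= n)%N -> t n < e.
  move=> e0; have [N _ HN] := near_infty_natSinv_expn_lt (PosNum e0).
  by exists N => n; exact: HN.
exists f; split.
- move=> x; apply/cvgrPdist_lt => e e0.
  have [|n /(_ n (leqnn n)) tn] := tsmall (e / 2); first by rewrite divr_gt0.
  have cS : continuous (S n).
    rewrite /S; apply: continuous_big; first exact: add_continuous.
    by move=> k _ z; apply: cvgMl; exact: cu.
  have /cvgrPdist_lt/(_ (e / 2)) Sx := cS x.
  have {}Sx := Sx ltac:(by rewrite divr_gt0).
  apply: filterS Sx => y; rewrite !ltr_distl => /andP[Sxy Sxy'].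
  have /andP[? ?] := fS n x; have /andP[? ?] := fS n y.
  by apply/andP; split; lra.
- move=> x y uxy [k ukxy].
  have d0 : 0 < (u k y - u k x) * t k.+1 by rewrite mulr_gt0// subr_gt0.
  have [N tN] := tsmall _ d0.
  have gap n : (k < n)%N -> (u k y - u k x) * t k.+1 <= S n y - S n x.
    elim: n => // n IH; rewrite ltnS leq_eqVlt !SS !uS => /orP[/eqP kn|/IH].
      subst n; have : S k x <= S k y.
        by apply: ler_sum => i _; rewrite ler_pM2r// invr_gt0 exprn_gt0.
      by lra.
    have := uxy n; have := t0 n.+1; nra.
  have := gap (maxn N k.+1) (leq_maxr _ _).
  have := tN (maxn N k.+1) (leq_maxl _ _).
  have /andP[_ ?] := fS (maxn N k.+1) x.
  have /andP[? _] := fS (maxn N k.+1) y.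
  by lra.
Qed.

(** * Continuous injections of a continuum into the reals *)

Lemma continuous_bij_homeomorphic (S T : topologicalType) (f : S -> T) :
  compact [set: S] -> hausdorff_space T -> continuous f -> bijective f ->
  homeomorphic S T.
Proof.
move=> cS hT cf [g fK gK]; exists f, g; split => //.
apply/continuous_closedP => A cA.
have -> : g @^-1` A = f @` A.
  apply/seteqP; split => [y Agy|_ [x Ax <-]] /=; last by rewrite fK.
  by exists (g y).
apply: compact_closed => //; apply: continuous_compact.
  exact: continuous_subspaceT.
exact: subclosed_compact cA cS _.
Qed.

Lemma hausdorff_set_type (T : topologicalType) (A : set T) :
  hausdorff_space T -> hausdorff_space (set_type A).
Proof.
rewrite !open_hausdorff => hT x y xy.
have : set_val x != set_val y.
  by apply: contra_neq xy; exact: val_inj.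
move=> /hT [[U V] /= [xU yV] [oU oV UV]].
exists (set_val @^-1` U, set_val @^-1` V); split => /=.
- by rewrite inE in xU; rewrite inE.
- by rewrite inE in yV; rewrite inE.
- by exists U.
- by exists V.
- by apply/eqP; rewrite -preimage_setI (eqP UV) preimage_set0.
Qed.

(** The image is the interval between the minimum and the maximum of f, by
    connectedness, and an affine map takes it onto [0, 1]. *)
Lemma injection_homeomorphic_itv (R : realType) (X : topologicalType)
    (f : X -> R) :
  compact [set: X] -> connected [set: X] -> (exists a b : X, a <> b) ->
  continuous f -> injective f -> homeomorphic X (set_type `[0 : R, 1]).
Proof.
move=> kX cX [a0 [b0 ab0]] cf injf.
have X0 : [set: X] !=set0 by exists a0.
have cfT : {within [set: X], continuous f} by exact: continuous_subspaceT.
have [a _ fa] := compact_EVT_min X0 kX cfT.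
have [b _ fb] := compact_EVT_max X0 kX cfT.
have {}fa x : f a <= f x by apply: fa; rewrite inE.
have {}fb x : f x <= f b by apply: fb; rewrite inE.
have ab : f a < f b.
  rewrite lt_neqAle fb andbT; apply/eqP => fab; apply: ab0; apply: injf.
  by apply/eqP; rewrite eq_le; have := fa a0; have := fb a0; have := fa b0;
     have := fb b0; rewrite -fab => *; apply/andP; split; lra.
have d0 : 0 < f b - f a by rewrite subr_gt0.
pose h x := (f x - f a) / (f b - f a).
have h01 x : h x \in [set` `[0 : R, 1]].
  rewrite inE /= in_itv /= /h divr_ge0 ?subr_ge0 ?(ltW ab)//=.
  by rewrite ler_pdivrMr// mul1r lerB.
pose F x : set_type `[0 : R, 1] := exist _ (h x) (h01 x).
have ch : continuous h.
  by move=> x; apply: cvgMl; apply: cvgB (cf x) (cvg_cst _).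
have cF : continuous F by exact: continuous_comp_initial.
apply: (@continuous_bij_homeomorphic _ _ F) => //.
  exact: hausdorff_set_type (@Rhausdorff R).
rewrite -setTT_bijective; split => //.
- move=> x y _ _ [] /(divIf (lt0r_neq0 d0)) /addIr; exact: injf.
- move=> [r r01] _; have := r01; rewrite inE /= in_itv /= => /andP[r0 r1].
  have /connected_intervalP itv : connected (f @` [set: X]).
    exact: connected_continuous_connected.
  have [x _ fx] : (f @` setT) (f a + r * (f b - f a)).
    apply: (itv (f a) (f b)); [by exists a | by exists b |].
    by apply/andP; split; nra.
  exists x => //; apply: val_inj => /=.
  by rewrite /h fx addrC addKr mulfK// lt0r_neq0.
Qed.

(** * The order yields an injection *)

Lemma continuous_mdist (R : realType) (X : metricType R) (q : X) :
  continuous (fun y => mdist q y : R).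
Proof.
move=> x; apply/cvgrPdist_lt => e e0.
apply/metricType_numDomainType.nbhs_mdistP; exists e => //= y /= xy.
have := metric_triangle q x y; have := metric_triangle q y x.
by rewrite (metric_sym y x) ltr_distl => *; apply/andP; split; lra.
Qed.

(** The sum over k of the distances from q_k to the lower ray of x, truncated at
    1 and weighted by 2^-(k+1).  Lower rays grow with x, so no distance
    increases; density of q makes one of them decrease strictly. *)
Lemma continuous_strictly_antitone (R : realType) (X : metricType R)
    (le : X -> X -> Prop) (q : nat -> X) :
  compact [set: X] -> closed_linear_order le -> dense (range q) ->
  exists f : X -> R, continuous f /\
    forall x y, le x y -> x <> y -> f y < f x.
Proof.
move=> cX lo dq.
have hX := @metric_hausdorff R X.
pose h k y : R := Num.min (mdist (q k) y) 1.
have h0 k y : 0 <= h k y by rewrite /h le_min mdist_ge0 ler01.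
have ch k : continuous (h k).
  by move=> y; apply: continuous_min; [exact: continuous_mdist | exact: cvg_cst].
have u01 k x : 0 <= running_inf le (h k) x <= 1.
  apply/andP; split; first exact: running_inf_ge.
  apply: le_trans (running_inf_le lo (h0 k) (clo_refl x lo)) _.
  by rewrite /h ge_min lexx orbT.
have [f [cf fP]] := dyadic_series
  (fun k => continuous_running_inf lo (h0 k) hX cX (ch k)) u01.
exists f; split => // x y xy xny.
apply: fP => [k|]; first exact: running_inf_antitone.
have oy : open (~` [set z | le z x]) by apply: closed_openC; exact: closed_lower_ray.
have nyx : (~` [set z | le z x]) y by move=> /(clo_anti lo xy).
have /metricType_numDomainType.nbhs_mdistP [e /= e0 ye] :=
  open_nbhs_nbhs (conj oy nyx).
pose r := Num.min e 1.
have r0 : 0 < r by rewrite /r lt_min e0 ltr01.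
have yr : (ball y (r / 2))° !=set0.
  by exists y; apply: nbhsx_ballx; rewrite divr_gt0.
have [p [/= yqk [k _ kp]]] := dq _ yr (@open_interior _ _); subst p.
have {}yqk : mdist y (q k) < r / 2.
  by move/interior_subset: yqk; rewrite ballEmdist.
(* The ball of radius r around y misses the lower ray of x, and q_k is within
   r / 2 of y: so q_k is at least r / 2 away from the lower ray of x. *)
exists k; apply: (@lt_le_trans _ _ (r / 2)).
  apply: le_lt_trans (running_inf_le lo (h0 k) (clo_refl y lo)) _.
  by rewrite /h gt_min metric_sym yqk.
apply: running_inf_ge => // z zx; rewrite leNgt; apply/negP.
have r1 : r <= 1 by rewrite /r ge_min lexx orbT.
have re : r <= e by rewrite /r ge_min lexx.
rewrite /h gt_min => /orP[qz|]; last by lra.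
by apply: (ye z) zx => /=; have := metric_triangle y (q k) z; lra.
Qed.

(** The sequence enumerates one point in the i-th link of the n-th chain, for all
    pairs (n, i) coded as natural numbers; the default value [x0] fills the
    indices that code no link. *)
Lemma chain_sequence_dense (R : realType) (X : metricType R)
    (D : nat -> seq (set X)) (x0 : X) :
  chain_sequence D -> exists q : nat -> X, dense (range q).
Proof.
move=> chD.
pose q k := if unpickle k is Some (n, i) then xget x0 (link (D n) i) else x0.
exists q => O [x Ox] oO.
have /metricType_numDomainType.nbhs_mdistP [e /= e0 xe] :=
  open_nbhs_nbhs (conj oO Ox).
have [N _ /(_ N (leqnn N)) /= DN] := chain_sequence_near chD e0.
have [i iD xi] := covers_ex x (chD.1 N).2.
exists (q (pickle (N, i))); split; last by exists (pickle (N, i)).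
apply: xe; rewrite /q pickleK; exact: mdist_link DN xi (xgetI _ xi).
Qed.

Unset Implicit Arguments.

Theorem theorem7p3 (R : realType) (X : metricType R)
    (contX : continuum X) (nondegX : exists a b : X, a <> b)
    (chainX : chainable X)
    (D : nat -> seq (set X)) (chD : chain_sequence D)
    (U : set_system nat) (npU : nonprincipal_ultrafilter U)
    (closedM : closed [set p : X * X | le_ultra D U p.1 p.2]) :
  homeomorphic X (set_type `[0 : R, 1]).
Proof.
have [kX cX] := contX; have [x0 _] := nondegX.
have lo : closed_linear_order (le_ultra D U).
  split => [x y|x y|x y z|//].
  - exact: le_ultra_total.
  - exact: le_ultra_anti.
  - exact: le_ultra_trans.
have [q dq] := chain_sequence_dense x0 chD.
have [f [cf fanti]] := continuous_strictly_antitone kX lo dq.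
apply: (injection_homeomorphic_itv kX cX nondegX cf) => x y fxy.
apply: contrapT => xy; case: (clo_total lo x y) => [le_xy|le_yx].
  by have := fanti _ _ le_xy xy; rewrite fxy ltxx.
by have := fanti _ _ le_yx (nesym xy); rewrite fxy ltxx.
Qed.
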